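(* Let $d\ge 1$ be an integer. For every uniformly splittable family $(X_i)_{i\in I}$ of centered random fields $X_i=(X_{t,i})_{t\in\mathbb R^d}$ on $\mathbb R^d$ there exists $C\in(1,\infty)$ such that for every $i\in I$, every box $B\subset\mathbb R^d$ and every $\lambda\in\mathbb R$: if $$C|\lambda|\le\frac1{(\log \operatorname{vol}B)^d}\quad\text{and}\quad \operatorname{width}B\ge C,$$ then $$\log\mathbb E\exp\Big(\lambda\int_B X_{t,i}\,dt\Big)\le C\,(\operatorname{vol}B)\,\lambda^2 .$$
   Context: Boxes. For $d\ge1$ a box in $\mathbb R^d$ is a set $B=[\alpha_1,\beta_1]\times\dots\times[\alpha_d,\beta_d]$ with $\alpha_j<\beta_j$ for all $j$. $\operatorname{vol}B=\prod_j(\beta_j-\alpha_j)$ and $\operatorname{width}B=\min_j(\beta_j-\alpha_j)$. Centered random fields. For $d\ge1$, a centered random field $X$ on $\mathbb R^d$ is a family of random variables on a probability space indexed by the boxes $B\subset\mathbb R^d$; the variable with index $B$ is denoted $\int_B X_t\,dt$ (or $\int_B X(t)\,dt$; this is only notation, no individual variables $X_t$ are assumed to exist). It is required that (i) (additivity) for each coordinate $k$, whenever a box $B$ is divided by a hyperplane $\{x_k=c\}$ into two boxes $B_1,B_2$, one has $\int_{B_1}X_t\,dt+\int_{B_2}X_t\,dt=\int_B X_t\,dt$ a.s.; (ii) $\mathbb E|\int_B X_t\,dt|<\infty$ and $\mathbb E\int_B X_t\,dt=0$ for all boxes $B$. A centered random field on $\mathbb R^0$ is a single integrable random variable of mean zero.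 Two fields are identically distributed if the corresponding box-indexed families have the same joint distributions; two fields on the same probability space are independent if the two box-indexed families are independent. Splits and leaks. A split of a centered random field $X$ on $\mathbb R^d$ ($d\ge1$) is a triple of random fields $X^0,X^-,X^+$ on some common probability space such that $X^-$ and $X^+$ are independent and $X,X^0,X^-,X^+$ are identically distributed. For $k\in\{1,\dots,d\}$ and $a<r<b$, the leak of the split along the hyperplane $\{x_k=r\}$ on the strip $\{a\le x_k\le b\}$ is the centered random field $Y$ on $\mathbb R^{d-1}$ given, for boxes $B\subset\mathbb R^{d-1}$, by $\int_B Y(t)\,dt=\int_{B_{[a,r]}}X^-(t)\,dt+\int_{B_{[r,b]}}X^+(t)\,dt-\int_{B_{[a,b]}}X^0(t)\,dt$, where $B_{[u,w]}\subset\mathbb R^d$ is the box obtained by inserting the interval $[u,w]$ as the $k$-th factor into $B$ (for $k=1$: $B_{[u,w]}=[u,w]\times B$). For $d=1$ the leak is the random variable $\int_{[a,r]}X^-(t)\,dt+\int_{[r,b]}X^+(t)\,dt-\int_{[a,b]}X^0(t)\,dt$. Uniform splittability (defined recursively in $d$). A family $(X_i)_{i\in I}$ (arbitrary index set $I$) of centered random fields on $\mathbb R^d$ is uniformly splittable if either $d=0$ and there is $\varepsilon>0$ with $\mathbb E\exp(\varepsilon|X_i|)\le2$ for all $i\in I$; or $d\ge1$ and both: (a) there exist a box $B\subset\mathbb R^d$ and $\varepsilon>0$ such that $\mathbb E\exp\big(\varepsilon|\int_{B+s}X_i(t)\,dt|\big)\le2$ for all $i\in I$ and $s\in\mathbb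 R^d$; (b) there exist splits $(X^0_{k,r,i},X^-_{k,r,i},X^+_{k,r,i})$ of $X_i$, for all $i\in I$, $k\in\{1,\dots,d\}$, $r\in\mathbb R$, such that the family $(Y_{k,r,a,b,i})$, indexed by all $k\in\{1,\dots,d\}$, $a<r<b$, $i\in I$, of their leaks (where $Y_{k,r,a,b,i}$ is the leak of the split $(X^0_{k,r,i},X^-_{k,r,i},X^+_{k,r,i})$ along $\{x_k=r\}$ on $\{a\le x_k\le b\}$) is a uniformly splittable family of centered random fields on $\mathbb R^{d-1}$. *)

(* Defs.v *)
From HB Require Import structures.
From mathcomp Require Import all_boot all_order all_algebra.
From mathcomp Require Import all_classical all_reals all_analysis.
From mathcomp Require Import measurable_realfun.

Set Implicit Arguments.
Unset Strict Implicit.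
Unset Printing Implicit Defensive.

Import Order.TTheory GRing.Theory Num.Theory.

Local Open Scope classical_set_scope.
Local Open Scope ring_scope.

(* The box [lo_1, hi_1] x ... x [lo_d, hi_d].  Its sides are nondegenerate, so
   the corner vectors and the box as a subset of R^d determine each other.
   There is exactly one box in R^0. *)
Record box (R : realType) (d : nat) := Box {
  lo : 'rV[R]_d;
  hi : 'rV[R]_d;
  lo_lt_hi : forall j, lo 0 j < hi 0 j }.

Definition vol (R : realType) (d : nat) (B : box R d) : R :=
  \prod_(j < d) (hi B 0 j - lo B 0 j).

(* Extended-real valued so that the minimum has a neutral element; for d >= 1
   it is a real number. *)
Definition width (R : realType) (d : nat) (B : box R d) : \bar R :=
  \big[Order.min/+oo%E]_(j < d) (hi B 0 j - lo B 0 j)%:E.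

Lemma shift_box_subproof (R : realType) (d : nat) (B : box R d) (s : 'rV[R]_d) :
  forall j, (lo B + s) 0 j < (hi B + s) 0 j.
Proof. by move=> j; rewrite !mxE ltrD2r lo_lt_hi. Qed.

Definition shift_box (R : realType) (d : nat) (B : box R d) (s : 'rV[R]_d) :
  box R d := Box (shift_box_subproof B s).

Definition insert_coord (R : realType) (n : nat) (k : 'I_n.+1) (u : R)
    (v : 'rV[R]_n) : 'rV[R]_n.+1 :=
  \row_j (if unlift k j is Some i then v 0 i else u).

Lemma insert_box_subproof (R : realType) (n : nat) (k : 'I_n.+1) (u w : R)
    (uw : u < w) (B : box R n) :
  forall j, insert_coord k u (lo B) 0 j < insert_coord k w (hi B) 0 j.
Proof. by move=> j; rewrite !mxE; case: unliftP => // i _; exact: lo_lt_hi. Qed.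

(* B_[u, w] : the interval [u, w] is inserted as the k-th factor. *)
Definition insert_box (R : realType) (n : nat) (k : 'I_n.+1) (u w : R)
    (uw : u < w) (B : box R n) : box R n.+1 :=
  Box (insert_box_subproof k uw B).

(* The hyperplane {x_k = c} divides B into B1 (below) and B2 (above).  Since B1
   and B2 are boxes, c lies strictly between the k-th endpoints of B. *)
Definition divides_box (R : realType) (d : nat) (k : 'I_d) (c : R)
    (B B1 B2 : box R d) : Prop :=
  [/\ lo B1 = lo B,
      hi B1 = \row_j (if j == k then c else hi B 0 j),
      lo B2 = \row_j (if j == k then c else lo B 0 j) &
      hi B2 = hi B].

Section fields_on.
Context (disp : measure_display) (T : measurableType disp) (R : realType)
  (P : probability T R).

(* [fval X B] stands for the integral of X over B.  For d = 0 this is a single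
   centered integrable random variable. *)
Record field_on (d : nat) := FieldOn {
  fval : box R d -> {RV P >-> R};
  fval_add : forall (k : 'I_d) (c : R) (B B1 B2 : box R d),
    divides_box k c B B1 B2 ->
    {ae P, forall w, fval B1 w + fval B2 w = fval B w};
  fval_Lfun1 : forall B : box R d, (fval B : T -> R) \in Lfun P 1;
  fval_mean0 : forall B : box R d, ('E_P[fval B] = 0)%E }.

(* The sigma-algebra generated by all the variables of a field. *)
Definition field_sigma (d : nat) (X : field_on d) : set (set T) :=
  <<s \bigcup_(B in [set: box R d])
        preimage_set_system setT (fval X B : T -> R) measurable >>.

Definition independent_fields (d : nat) (X Y : field_on d) : Prop :=
  forall E F : set T, field_sigma X E -> field_sigma Y F ->
    P (E `&` F) = (P E * P F)%E.

End fields_on.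

(* Equality of all finite-dimensional distributions. *)
Definition same_law (R : realType) (d : nat)
    (disp1 : measure_display) (T1 : measurableType disp1) (P1 : probability T1 R)
    (disp2 : measure_display) (T2 : measurableType disp2) (P2 : probability T2 R)
    (X : field_on P1 d) (Y : field_on P2 d) : Prop :=
  forall (n : nat) (Bs : n.-tuple (box R d)) (A : set (n.-tuple R)),
    measurable A ->
    P1 [set w | A [tuple fval X (tnth Bs i) w | i < n]] =
    P2 [set w | A [tuple fval Y (tnth Bs i) w | i < n]].

(* A centered random field, together with its own probability space. *)
Record centered_field (R : realType) (d : nat) := CenteredField {
  cf_disp : measure_display;
  cf_space : measurableType cf_disp;
  cf_prob : probability cf_space R;
  cf_field :> field_on cf_prob d }.

Record field_split (R : realType) (n : nat) (X : centered_field R n.+1) := Split {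
  sp_disp : measure_display;
  sp_space : measurableType sp_disp;
  sp_prob : probability sp_space R;
  sp0 : field_on sp_prob n.+1;
  spm : field_on sp_prob n.+1;
  spp : field_on sp_prob n.+1;
  sp_indep : independent_fields spm spp;
  sp0_law : same_law X sp0;
  spm_law : same_law X spm;
  spp_law : same_law X spp }.

Section leak.
Context (R : realType) (n : nat) (X : centered_field R n.+1) (S : field_split X)
  (k : 'I_n.+1) (a r b : R) (ar : a < r) (rb : r < b).

Definition leak_val (B : box R n) : {RV (sp_prob S) >-> R} :=
  (fval (spm S) (insert_box k ar B) : {mfun sp_space S >-> R})
  + (fval (spp S) (insert_box k rb B) : {mfun sp_space S >-> R})
  - (fval (sp0 S) (insert_box k (lt_trans ar rb) B) : {mfun sp_space S >-> R}).

Lemma leak_valE (B : box R n) (w : sp_space S) : leak_val B w =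
  fval (spm S) (insert_box k ar B) w + fval (spp S) (insert_box k rb B) w
  - fval (sp0 S) (insert_box k (lt_trans ar rb) B) w.
Proof. by []. Qed.

Lemma divides_insert_box (u w : R) (uw : u < w) (k' : 'I_n) (c : R)
    (B B1 B2 : box R n) : divides_box k' c B B1 B2 ->
  divides_box (lift k k') c
    (insert_box k uw B) (insert_box k uw B1) (insert_box k uw B2).
Proof.
move=> [e1 e2 e3 e4]; split => /=; rewrite ?e1 ?e2 ?e3 ?e4 //;
  apply/rowP => j; rewrite !mxE; case: unliftP => [i ->|->];
  by rewrite ?(inj_eq lift_inj) ?mxE // (negbTE (neq_lift _ _)).
Qed.

Lemma leak_add (k' : 'I_n) (c : R) (B B1 B2 : box R n) :
  divides_box k' c B B1 B2 ->
  {ae (sp_prob S), forall w, leak_val B1 w + leak_val B2 w = leak_val B w}.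
Proof.
move=> BB.
have Hm := fval_add (spm S) (divides_insert_box ar BB).
have Hp := fval_add (spp S) (divides_insert_box rb BB).
have H0 := fval_add (sp0 S) (divides_insert_box (lt_trans ar rb) BB).
apply: filterS3 Hm Hp H0 => w /= em ep e0.
rewrite [RHS]leak_valE -em -ep -e0 opprD [LHS]addrACA; congr (_ + _).
exact: addrACA.
Qed.

Lemma leak_Lfun1 (B : box R n) : (leak_val B : _ -> R) \in Lfun (sp_prob S) 1.
Proof.
by apply: rpredB; [apply: rpredD|]; exact: fval_Lfun1.
Qed.

Lemma leak_mean0 (B : box R n) : ('E_(sp_prob S)[leak_val B] = 0)%E.
Proof.
rewrite [LHS]expectationB ?[X in (X - _)%E]expectationD ?fval_mean0 ?adde0 ?sube0 //;
  try exact: fval_Lfun1.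
by apply: rpredD; exact: fval_Lfun1.
Qed.

(* The leak along {x_k = r} on the strip {a <= x_k <= b}. *)
Definition leak : centered_field R n :=
  CenteredField (FieldOn leak_add leak_Lfun1 leak_mean0).

End leak.

Record strip (R : realType) := Strip {
  st_a : R; st_r : R; st_b : R;
  st_ar : st_a < st_r;
  st_rb : st_r < st_b }.

Definition exp_moment_le2 (R : realType) (d : nat) (X : centered_field R d)
    (B : box R d) (eps : R) : Prop :=
  ('E_(cf_prob X)[fun w => expR (eps * `|fval X B w|)] <= 2%:E)%E.

Fixpoint uniformly_splittable (R : realType) (d : nat) :
    forall I : Type, (I -> centered_field R d) -> Prop :=
  match d return forall I : Type, (I -> centered_field R d) -> Prop with
  | 0%N => fun I X =>
      exists2 eps : R, 0 < eps &
        forall (i : I) (B : box R 0), exp_moment_le2 (X i) B eps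
  | n.+1 => fun I X =>
      (exists (B : box R n.+1) (eps : R), 0 < eps /\
         forall (i : I) (s : 'rV[R]_n.+1),
           exp_moment_le2 (X i) (shift_box B s) eps) /\
      (exists S : forall (k : 'I_n.+1) (r : R) (i : I), field_split (X i),
         uniformly_splittable (fun p : 'I_n.+1 * strip R * I =>
           let: (k, st, i) := p in
           leak (S k (st_r st) i) k (st_ar st) (st_rb st)))
  end.

(* Main.v *)
(* Cutting a box in two by a hyperplane writes the integral over the box as a
   sum of two independent copies minus a leak, which is a field of one dimension
   less.  By Hoelder's inequality with exponents p = 1 + delta and p / delta,
   and with f(lambda) the supremum of log E exp (lambda X_B) over boxes B of
   a given shape, one doubling of a side costs
     f_double(lambda) <= (2 / p) f(p lambda) + (delta / p) f_leak(p lambda / delta),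
   and by induction on d the leak term is quadratic in lambda, with a
   coefficient proportional to the area of the cross-section.  If L is about
   log (vol B), then about L doublings are needed in all; the choice
   delta = 1 / L + (3/4)^m at the m-th doubling keeps the product of the p's
   bounded and makes the leak contributions, relative to the volume, summable.
   Since p / delta <= 2 L, each dimension costs one factor L in the admissible
   range of lambda.  For boxes of bounded size, exponential moments follow from
   hypothesis (a): enlarge the given box by additivity, then cut it down side by
   side; the part cut off is independent and centered, so Jensen's inequality
   discards it. *)
From HB Require Import structures.
Require Import Defs.
From mathcomp Require Import all_boot all_order all_algebra.
From mathcomp Require Import all_classical all_reals all_analysis.
From mathcomp Require Import measurable_realfun.
From mathcomp Require Import ring lra.

Set Implicit Arguments.
Unset Strict Implicit.
Unset Printing Implicit Defensive.

Import Order.TTheory GRing.Theory Num.Theory.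

Local Open Scope classical_set_scope.
Local Open Scope ring_scope.

(** * Elementary inequalities for the exponential function *)

Lemma expR_convex (R : realType) (s t x y : R) : 0 <= s -> 0 <= t -> s + t = 1 ->
  expR (s * x + t * y) <= s * expR x + t * expR y.
Proof.
move=> s0 t0 st1; set m := s * x + t * y.
have tangent z : expR m * (1 + (z - m)) <= expR z.
  have -> : expR z = expR m * expR (z - m) by rewrite -expRD addrC subrK.
  by rewrite ler_wpM2l ?expR_ge0 ?expR_ge1Dx.
rewrite (le_trans _ (lerD (ler_wpM2l s0 (tangent x)) (ler_wpM2l t0 (tangent y))))//.
rewrite le_eqVlt; apply/orP; left; apply/eqP.
have ts : t = 1 - s by lra.
by rewrite /m ts; ring.
Qed.

(** Multiplying 1 - x <= exp (- x) by exp x gives exp x - 1 <= x exp x. It remains to bound x (exp x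
    - 1) by x^2 exp |x|, separately for each sign of x. *)
Lemma expR_le_quadratic (R : realType) (x : R) :
  expR x <= 1 + x + x ^+ 2 * expR `|x|.
Proof.
have e1 : expR x - 1 <= x * expR x.
  have := ler_wpM2l (expR_ge0 x) (expR_ge1Dx (- x)).
  rewrite expRN divff ?gt_eqF ?expR_gt0// mulrDr mulr1 mulrN (mulrC _ x); lra.
have [x0|x0] := leP 0 x.
  rewrite ger0_norm//; have := ler_wpM2l x0 e1; rewrite expr2; nra.
have := expR_ge1Dx x; have : 1 <= expR `|x| by rewrite -expR0 ler_expR.
rewrite expr2; nra.
Qed.

Lemma sqr_le_expR (R : realType) (x : R) : 0 <= x -> x ^+ 2 <= 4 * expR x.
Proof.
move=> x0; have -> : expR x = expR (x / 2) ^+ 2.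
  by rewrite -expRM_natr; congr expR; field.
have := expR_ge1Dx (x / 2); rewrite !expr2; nra.
Qed.

(** * Exponential moments of a single random variable *)

Section mgf.
Context (disp : measure_display) (T : measurableType disp) (R : realType)
  (P : probability T R).
Implicit Types (U V Z : T -> R).

(** The exponentiated form avoids logarithms of extended reals and forces the exponential moment to
    be finite. *)
Definition log_mgf_le Z (K : R) : Prop :=
  ('E_P[fun w => expR (Z w)] <= (expR K)%:E)%E.

Lemma measurable_expR_comp Z : measurable_fun setT Z ->
  measurable_fun setT (fun w => expR (Z w)).
Proof. by move=> mZ; apply: measurableT_comp. Qed.

Lemma log_mgf_leW Z (K K' : R) : K <= K' -> log_mgf_le Z K -> log_mgf_le Z K'.
Proof. by move=> KK' /le_trans; apply; rewrite lee_fin ler_expR. Qed.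

Lemma ge0_expectation_lin (a b : R) U V : 0 <= a -> 0 <= b ->
  measurable_fun setT U -> measurable_fun setT V ->
  (forall w, 0 <= U w) -> (forall w, 0 <= V w) ->
  ('E_P[fun w => (a * U w + b * V w)%R] = a%:E * 'E_P[U] + b%:E * 'E_P[V])%E.
Proof.
move=> a0 b0 mU mV U0 V0; rewrite unlock.
under eq_integral do rewrite EFinD !EFinM.
rewrite ge0_integralD//; last 4 first.
- by move=> w _; rewrite mule_ge0// lee_fin.
- by apply: emeasurable_funM => //; apply/measurable_EFinP.
- by move=> w _; rewrite mule_ge0// lee_fin.
- by apply: emeasurable_funM => //; apply/measurable_EFinP.
by rewrite !ge0_integralZl_EFin//; try (by move=> w _; rewrite lee_fin);
  apply/measurable_EFinP.
Qed.

(* Hoelder's inequality in logarithmic form: applying convexity of exp to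
   s (U / s - a) + t (V / t - b) avoids powers of expectations. *)
Lemma log_mgf_le_hoelder (s t a b : R) U V : 0 < s -> 0 < t -> s + t = 1 ->
  measurable_fun setT U -> measurable_fun setT V ->
  log_mgf_le (fun w => s^-1 * U w) a -> log_mgf_le (fun w => t^-1 * V w) b ->
  log_mgf_le (fun w => U w + V w) (s * a + t * b).
Proof.
move=> s0 t0 st1 mU mV hU hV.
set K := s * a + t * b.
have mU' : measurable_fun setT (fun w => expR (s^-1 * U w)).
  by apply: measurable_expR_comp; apply: measurable_funM.
have mV' : measurable_fun setT (fun w => expR (t^-1 * V w)).
  by apply: measurable_expR_comp; apply: measurable_funM.
have cs : 0 <= expR K * s * expR (- a) by rewrite !mulr_ge0 ?expR_ge0 ?ltW.
have ct : 0 <= expR K * t * expR (- b) by rewrite !mulr_ge0 ?expR_ge0 ?ltW.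
apply: (@le_trans _ _ 'E_P[fun w => ((expR K * s * expR (- a)) * expR (s^-1 * U w)
   + (expR K * t * expR (- b)) * expR (t^-1 * V w))%R]%E).
  apply: expectation_le.
  - by apply: measurable_expR_comp; apply: measurable_funD.
  - by apply: measurable_funD; apply: measurable_funM.
  - by move=> w; apply: expR_ge0.
  - by move=> w; rewrite addr_ge0 ?mulr_ge0 ?expR_ge0 // ltW.
  - apply: aeW => w; rewrite -!mulrA -!expRD -mulrDr.
    have -> : U w + V w = K + (s * (- a + s^-1 * U w) + t * (- b + t^-1 * V w)).
      rewrite /K !mulrDr !mulrA !divff ?gt_eqF//; ring.
    rewrite [leLHS]expRD. rewrite ler_wpM2l ?expR_ge0//.
    by apply: expR_convex => //; apply: ltW.
rewrite ge0_expectation_lin//; try by move=> w; exact: expR_ge0.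
have e c x : expR K * c * expR (- x) * expR x = expR K * c.
  by rewrite -mulrA -expRD addNr expR0 mulr1.
apply: le_trans (leeD (lee_wpmul2l _ hU) (lee_wpmul2l _ hV)) _; rewrite ?lee_fin//.
by rewrite !e -mulrDr st1 mulr1.
Qed.

Lemma log_mgf_le_ae U V K : measurable_fun setT U -> measurable_fun setT V ->
  {ae P, forall w, U w = V w} -> log_mgf_le V K -> log_mgf_le U K.
Proof.
move=> mU mV UV; apply: le_trans; apply: expectation_le.
- exact: measurable_expR_comp.
- exact: measurable_expR_comp.
- by move=> w; apply: expR_ge0.
- by move=> w; apply: expR_ge0.
- by apply: filterS UV => w ->.
Qed.

Lemma measurable_scale (c : R) (Z : {RV P >-> R}) :
  measurable_fun setT (fun w => c * Z w).
Proof. exact: measurable_funM. Qed.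

Lemma expectation_scale (c : R) (Z : {RV P >-> R}) : (Z : T -> R) \in Lfun P 1 ->
  'E_P[Z]%E = 0%E -> 'E_P[fun w => (c * Z w)%R]%E = 0%E.
Proof.
move=> Z1 EZ0; have -> : (fun w => c * Z w) = c \o* Z.
  by apply/funext => w /=; rewrite mulrC.
by rewrite expectationZl// EZ0 mule0.
Qed.

Lemma Lfun1_scale (c : R) (Z : {RV P >-> R}) : (Z : T -> R) \in Lfun P 1 ->
  (fun w => c * Z w) \in Lfun P 1.
Proof.
move=> /Lfun1_integrable iZ; apply/Lfun1_integrable.
have -> : EFin \o (fun w => c * Z w) = (fun w => c%:E * (EFin \o Z) w)%E.
  by apply/funext => w.
exact: integrableZl.
Qed.

(** Jensen's inequality, by integrating 1 + V <= exp V. *)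
Lemma expectation_expR_ge1 V : V \in Lfun P 1 -> 'E_P[V]%E = 0%E ->
  (1 <= 'E_P[fun w => expR (V w)])%E.
Proof.
move=> V1 EV0.
have iV : P.-integrable setT (EFin \o V) by apply/Lfun1_integrable.
have mV : measurable_fun setT V.
  by have /integrableP[/measurable_EFinP] := iV.
have [|Efin] := eqVneq ('E_P[fun w => expR (V w)])%E +oo%E.
  by move=> ->; rewrite leey.
have iE : P.-integrable setT (EFin \o (fun w => expR (V w))).
  apply/integrableP; split; first by apply/measurable_EFinP/measurable_expR_comp.
  under eq_integral do rewrite /= ger0_norm ?expR_ge0//.
  by move: Efin; rewrite unlock -ltey.
have -> : 1%E = ('E_P[((cst 1) \+ V)%R])%E.
  rewrite expectationD ?expectation_cst ?EV0 ?adde0//.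
  exact: Lfun_cst.
rewrite unlock; apply: le_integral => //=.
- apply/Lfun1_integrable; apply: rpredD => //; exact: Lfun_cst.
- by move=> w _; rewrite lee_fin /=; exact: expR_ge1Dx.
Qed.

(** Centering kills the linear term of [expR_le_quadratic]. In the remainder, half of the exponent
    eps |Z| absorbs exp |lambda Z| and the other half absorbs Z^2. *)
Lemma log_mgf_le_subgaussian (eps K lambda : R) (Z : {RV P >-> R}) :
  0 < eps -> (Z : T -> R) \in Lfun P 1 -> 'E_P[Z]%E = 0%E ->
  ('E_P[fun w => expR (eps * `|Z w|)] <= K%:E)%E ->
  `|lambda| <= eps / 2 ->
  log_mgf_le (fun w => lambda * Z w) (16 * K / eps ^+ 2 * lambda ^+ 2).
Proof.
move=> eps0 Z1 EZ0 hK hl.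
(* From (eps |Z| / 2)^2 <= 4 exp (eps |Z| / 2) one gets Z^2 <= (16 / eps^2) exp (eps |Z| / 2). *)
set c := 16 / eps ^+ 2 * lambda ^+ 2.
have c0 : 0 <= c by rewrite /c mulr_ge0 ?sqr_ge0 ?divr_ge0 ?sqr_ge0.
have mE : measurable_fun setT (fun w => expR (eps * `|Z w|)).
  apply: measurable_expR_comp; apply: measurable_funM => //.
  by apply: measurableT_comp => //; exact: measurable_funP.
have iE : (fun w => c * expR (eps * `|Z w|)) \in Lfun P 1.
  apply/Lfun1_integrable.
  have -> : EFin \o (fun w => c * expR (eps * `|Z w|)) =
     (fun w => c%:E * (EFin \o (fun w => expR (eps * `|Z w|))) w)%E.
    by apply/funext.
  apply: integrableZl => //; apply/integrableP; split; first exact/measurable_EFinP.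
  under eq_integral do rewrite /= ger0_norm ?expR_ge0//.
  by rewrite unlock in hK; apply: le_lt_trans hK _; rewrite ltry.
pose L w := 1 + lambda * Z w.
have iL : L \in Lfun P 1.
  by apply: rpredD; [exact: Lfun_cst|exact: Lfun1_scale].
have ptw w : expR (lambda * Z w) <= L w + c * expR (eps * `|Z w|).
  apply: le_trans (expR_le_quadratic _) _; rewrite lerD2l.
  have h1 : expR `|lambda * Z w| <= expR (eps / 2 * `|Z w|).
    by rewrite ler_expR normrM ler_wpM2r.
  have h2 : (eps / 2 * `|Z w|) ^+ 2 <= 4 * expR (eps / 2 * `|Z w|).
    by apply: sqr_le_expR; rewrite mulr_ge0 ?divr_ge0 // ltW.
  have -> : expR (eps * `|Z w|) = expR (eps / 2 * `|Z w|) * expR (eps / 2 * `|Z w|).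
    by rewrite -expRD -mulrDl -splitr.
  rewrite mulrA ler_pM ?sqr_ge0 ?expR_ge0//.
  rewrite exprMn mulrC -(real_normK (num_real (Z w))).
  have -> : c = 16 / eps ^+ 2 * lambda ^+ 2 by [].
  have -> : `|Z w| ^+ 2 * lambda ^+ 2 =
            (4 / eps ^+ 2 * lambda ^+ 2) * (eps / 2 * `|Z w|) ^+ 2.
    by field; rewrite gt_eqF.
  apply: (@le_trans _ _ ((4 / eps ^+ 2 * lambda ^+ 2) * (4 * expR (eps / 2 * `|Z w|)))).
    by rewrite ler_wpM2l// mulr_ge0 ?sqr_ge0// divr_ge0 ?sqr_ge0.
  by rewrite le_eqVlt; apply/orP; left; apply/eqP; ring.
apply: (@le_trans _ _ ('E_P[(L \+ (fun w => c * expR (eps * `|Z w|)))%R])%E).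
  apply: expectation_le.
  - exact/measurable_expR_comp/measurable_scale.
  - apply: measurable_funD; last exact: measurable_funM.
    by apply: measurable_funD => //; exact: measurable_scale.
  - by move=> w; apply: expR_ge0.
  - by move=> w; apply: le_trans (ptw w); apply: expR_ge0.
  - exact: aeW.
rewrite expectationD//.
have -> : ('E_P[L] = 1)%E.
  rewrite [LHS](@expectationD _ _ _ P (cst 1) (fun w => lambda * Z w)).
  - by rewrite expectation_cst expectation_scale// adde0.
  - exact: Lfun_cst.
  - exact: Lfun1_scale.
have -> : ('E_P[fun w => (c * expR (eps * `|Z w|))%R] =
          c%:E * 'E_P[fun w => expR (eps * `|Z w|)])%E.
  rewrite unlock; under eq_integral do rewrite EFinM.
  by rewrite ge0_integralZl_EFin//; exact/measurable_EFinP.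
apply: le_trans (leeD (le_refl _) (lee_wpmul2l _ hK)) _; rewrite ?lee_fin//.
apply: le_trans (expR_ge1Dx _); rewrite /c lerD2l.
by rewrite le_eqVlt; apply/orP; left; apply/eqP; field; rewrite gt_eqF.
Qed.

Lemma expectation_expR_norm_le (eps K : R) (Z : {RV P >-> R}) : 0 <= eps ->
  log_mgf_le (fun w => eps * Z w) K -> log_mgf_le (fun w => - eps * Z w) K ->
  ('E_P[fun w => expR (eps * `|Z w|)] <= (2 * expR K)%:E)%E.
Proof.
move=> eps0 h1 h2.
apply: (@le_trans _ _ 'E_P[fun w => (1 * expR (eps * Z w) + 1 * expR (- eps * Z w))%R]%E).
  apply: expectation_le.
  - apply: measurable_expR_comp; apply: measurable_funM => //.
    by apply: measurableT_comp => //; exact: measurable_funP.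
  - by apply: measurable_funD; apply: measurable_funM => //;
      exact/measurable_expR_comp/measurable_scale.
  - by move=> w; apply: expR_ge0.
  - by move=> w; rewrite !mul1r addr_ge0 ?expR_ge0.
  - apply: aeW => w; rewrite !mul1r; have [z|z] := leP 0 (Z w).
      by rewrite ger0_norm// lerDl expR_ge0.
    by rewrite ltr0_norm// mulrN mulNr lerDr expR_ge0.
rewrite ge0_expectation_lin//; try (by move=> w; apply: expR_ge0);
  try exact/measurable_expR_comp/measurable_scale.
by rewrite !mul1e mulr_natl mulr2n EFinD leeD.
Qed.

End mgf.

(** * Independence and equality in law *)

Section independence.
Context (disp : measure_display) (T : measurableType disp) (R : realType)
  (P : probability T R).

(** Independence makes the law of the pair (U, V) a product measure; Tonelli's theorem then factors
    the nonnegative integral, infinite values included. *)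
Lemma expectation_expR_indep (U V : {RV P >-> R}) (lambda : R) :
  (forall A B : set R, measurable A -> measurable B ->
    P (U @^-1` A `&` V @^-1` B) = (P (U @^-1` A) * P (V @^-1` B))%E) ->
  ('E_P[fun w => expR (lambda * U w + lambda * V w)] =
   'E_P[fun w => expR (lambda * U w)] * 'E_P[fun w => expR (lambda * V w)])%E.
Proof.
move=> indep.
have mW : measurable_fun setT (fun w => (U w, V w)).
  by apply: measurable_fun_pair; exact: measurable_funP.
pose W : {mfun T >-> (R * R)%type} :=
  HB.pack (fun w => (U w, V w)) (isMeasurableFun.Build _ _ _ _ _ mW).
pose e (x : R) := (expR (lambda * x))%:E.
have me : measurable_fun setT e.
  by apply/measurable_EFinP/measurable_expR_comp; exact: measurable_funM.
have e0 x : (0 <= e x)%E by rewrite lee_fin expR_ge0.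
pose f (z : R * R) := (e z.1 * e z.2)%E.
have mf : measurable_fun setT f.
  by apply: emeasurable_funM; apply: measurableT_comp.
have f0 z : (0 <= f z)%E by rewrite mule_ge0.
rewrite unlock.
transitivity (\int[distribution P W]_z f z)%E.
  rewrite ge0_integral_distribution//.
  by apply: eq_integral => w _; rewrite /f /e /= -EFinM -expRD.
rewrite -(@eq_measure_integral _ _ _ setT (distribution P W)
  (distribution P U \x distribution P V)%E); last first.
  by move=> A mA _; apply: product_measure_unique => // B C mB mC; exact: indep.
rewrite fubini_tonelli1// /fubini_F.
under eq_integral do rewrite /f /= ge0_integralZl//.
rewrite -(ge0_integral_distribution U me e0) -(ge0_integral_distribution V me e0).
rewrite ge0_integralZr//.
by apply: integral_ge0.
Qed.

Variable d : nat.

Lemma field_sigma_preimage (X : field_on P d) (B : box R d) (A : set R) :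
  measurable A -> field_sigma X (fval X B @^-1` A).
Proof.
move=> mA; apply: sub_sigma_algebra; exists B => //.
by exists A => //; rewrite setTI.
Qed.

Lemma log_mgf_le_indep_sum (X Y : field_on P d) (B B' : box R d) (lambda a b : R) :
  independent_fields X Y ->
  log_mgf_le P (fun w => lambda * fval X B w) a ->
  log_mgf_le P (fun w => lambda * fval Y B' w) b ->
  log_mgf_le P (fun w => lambda * fval X B w + lambda * fval Y B' w) (a + b).
Proof.
move=> indep ha hb; rewrite /log_mgf_le expectation_expR_indep; last first.
  by move=> A A' mA mA'; apply: indep; exact: field_sigma_preimage.
by rewrite expRD EFinM lee_pmul// expectation_ge0// => w; exact: expR_ge0.
Qed.

(* Jensen's inequality in the second, centered, variable. *)
Lemma log_mgf_le_indep_summand (X Y : field_on P d) (B B' : box R d) (lambda K : R) :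
  independent_fields X Y ->
  log_mgf_le P (fun w => lambda * fval X B w + lambda * fval Y B' w) K ->
  log_mgf_le P (fun w => lambda * fval X B w) K.
Proof.
move=> indep; rewrite /log_mgf_le expectation_expR_indep; last first.
  by move=> A A' mA mA'; apply: indep; exact: field_sigma_preimage.
apply: le_trans; rewrite -[leLHS]mule1 lee_pmul//.
  by apply: expectation_ge0 => w; exact: expR_ge0.
apply: expectation_expR_ge1; first exact/Lfun1_scale/fval_Lfun1.
exact/expectation_scale/fval_mean0/fval_Lfun1.
Qed.

End independence.

Section same_law.
Context (R : realType) (d : nat).
Context (disp1 : measure_display) (T1 : measurableType disp1) (P1 : probability T1 R).
Context (disp2 : measure_display) (T2 : measurableType disp2) (P2 : probability T2 R).
Context (X : field_on P1 d) (Y : field_on P2 d).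

(** The expectation is an integral against the law of one variable, which [same_law] with n = 1
    determines. *)
Lemma same_law_expectation_expR (B : box R d) (lambda : R) : same_law X Y ->
  ('E_P1[fun w => expR (lambda * fval X B w)] =
   'E_P2[fun w => expR (lambda * fval Y B w)])%E.
Proof.
move=> XY; pose e (x : R) := (expR (lambda * x))%:E.
have me : measurable_fun setT e.
  by apply/measurable_EFinP/measurable_expR_comp; exact: measurable_funM.
have e0 x : (0 <= e x)%E by rewrite lee_fin expR_ge0.
rewrite unlock.
rewrite -(ge0_integral_distribution (fval X B) me e0).
rewrite -(ge0_integral_distribution (fval Y B) me e0).
apply: eq_measure_integral => A mA _.
have mA1 : measurable ((fun t : 1.-tuple R => tnth t ord0) @^-1` A).
  by rewrite -[X in measurable X]setTI; exact: measurable_tnth.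
have := XY 1%N [tuple B] _ mA1.
rewrite /distribution /pushforward /= => E.
by congr (_ = _) : E; congr (_ _); apply/seteqP; split => w /=; rewrite tnth_mktuple.
Qed.

Lemma same_law_log_mgf_le (B : box R d) (lambda K : R) : same_law X Y ->
  log_mgf_le P1 (fun w => lambda * fval X B w) K <->
  log_mgf_le P2 (fun w => lambda * fval Y B w) K.
Proof. by move=> XY; rewrite /log_mgf_le (same_law_expectation_expR _ _ XY). Qed.

End same_law.

(** * Geometry of boxes *)

Section boxes.
Context (R : realType).

Lemma box_eq (d : nat) (B B' : box R d) : lo B = lo B' -> hi B = hi B' -> B = B'.
Proof.
case: B B' => l h p [l' h' p'] /= e e'; case: _ / e in p' *; case: _ / e' in p' *.
by congr Box; exact: Prop_irrelevance.
Qed.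

Definition side (d : nat) (B : box R d) (j : 'I_d) : R := hi B 0 j - lo B 0 j.

Definition sides_in (d : nat) (A : 'I_d -> set R) (B : box R d) : Prop :=
  forall j, A j (side B j).

Lemma side_gt0 (d : nat) (B : box R d) j : 0 < side B j.
Proof. by rewrite subr_gt0 lo_lt_hi. Qed.

Lemma vol_gt0 (d : nat) (B : box R d) : 0 < vol B.
Proof. by apply: prodr_gt0 => j _; exact: side_gt0. Qed.

Lemma vol_ge1 (d : nat) (B : box R d) : (forall j, 1 <= side B j) -> 1 <= vol B.
Proof.
move=> h; have : \prod_(j < d) (1 : R) <= vol B; last by rewrite big1_eq.
by apply: ler_prod => j _; rewrite ler01 h.
Qed.

Lemma vol_le_exp (d : nat) (B : box R d) (M : R) :
  (forall j, side B j <= M) -> vol B <= M ^+ d.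
Proof.
move=> h; rewrite -[d in M ^+ d]card_ord -prodr_const.
by apply: ler_prod => j _; rewrite h ltW// side_gt0.
Qed.

Variable n : nat.
Implicit Types (k : 'I_n.+1) (B : box R n).

Lemma insert_boxP k (B : box R n.+1) :
  exists (u w : R) (uw : u < w) (B' : box R n), B = insert_box k uw B'.
Proof.
have p : forall j, (\row_i lo B 0 (lift k i)) 0 j < (\row_i hi B 0 (lift k i)) 0 j.
  by move=> j; rewrite !mxE lo_lt_hi.
exists (lo B 0 k), (hi B 0 k), (lo_lt_hi B k), (Box p).
by apply: box_eq; apply/rowP => j; rewrite /= !mxE;
  case: unliftP => [i|] ->; rewrite ?mxE.
Qed.

Lemma side_insert_box k u w (uw : u < w) B : side (insert_box k uw B) k = w - u.
Proof. by rewrite /side /= !mxE unlift_none. Qed.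

Lemma side_insert_box_lift k u w (uw : u < w) B i :
  side (insert_box k uw B) (lift k i) = side B i.
Proof. by rewrite /side /= !mxE liftK. Qed.

Lemma vol_insert_box k u w (uw : u < w) B : vol (insert_box k uw B) = (w - u) * vol B.
Proof.
rewrite /vol (bigD1_ord k) //= !mxE unlift_none; congr (_ * _).
by apply: eq_bigr => i _; rewrite !mxE liftK.
Qed.

Lemma sides_in_insert_box (A : 'I_n.+1 -> set R) k u w (uw : u < w) B :
  sides_in A (insert_box k uw B) <->
  A k (w - u) /\ sides_in (fun i => A (lift k i)) B.
Proof.
split=> [h|[hk h] j].
  split=> [|i]; first by rewrite -(side_insert_box k uw B); exact: h.
  by rewrite -(side_insert_box_lift k uw B); exact: h.
by case: (unliftP k j) => [i ->|->]; rewrite ?side_insert_box ?side_insert_box_lift.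
Qed.

Lemma divides_box_insert k u r w (ur : u < r) (rw : r < w) (uw : u < w) B :
  divides_box k r (insert_box k uw B) (insert_box k ur B) (insert_box k rw B).
Proof.
split=> //=; apply/rowP => j; rewrite !mxE.
  by case: unliftP => [i ->|->]; rewrite ?eqxx// -[lift k i == k]negbK -eq_sym neq_lift.
by case: unliftP => [i ->|->]; rewrite ?eqxx// -[lift k i == k]negbK -eq_sym neq_lift.
Qed.

End boxes.

(** * Replacing the constraints on the sides one at a time *)

Section coordinatewise.
Context (U : Type) (d : nat).
Implicit Types (A : 'I_d -> U).

Definition upd (k : 'I_d) (a : U) A : 'I_d -> U := fun j => if j == k then a else A j.

(** A hybrid argument: the intermediate family takes [A'] at the first m indices and [A] at the
    others. The step may use that the family is such a mixture, still unchanged at k, so side bounds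
    valid for both [A] and [A'] persist. *)
Lemma coordinatewise_ind (Q : ('I_d -> U) -> Prop) A A' :
  (forall k T, (forall j, T j = A j \/ T j = A' j) -> T k = A k ->
     Q T -> Q (upd k (A' k) T)) ->
  Q A -> Q A'.
Proof.
move=> step QA.
pose T (m : nat) : 'I_d -> U := fun j => if (j < m)%N then A' j else A j.
have QT m : (m <= d)%N -> Q (T m).
  elim: m => [|m IH] md; first by have -> : T 0%N = A by apply/funext.
  pose k := Ordinal md.
  have -> : T m.+1 = upd k (A' k) (T m).
    apply/funext => j; rewrite /T /upd; have [->|jk] := eqVneq j k.
      by rewrite /= ltnS leqnn.
    by rewrite ltnS leq_eqVlt; move: jk; rewrite -val_eqE /= => /negbTE ->.
  apply: step; [|by rewrite /T ltnn|exact/IH/ltnW].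
  by move=> j; rewrite /T; case: ifP; [right|left].
have <- : T d = A' by apply/funext => j; rewrite /T ltn_ord.
exact: QT.
Qed.

End coordinatewise.

Definition field_log_mgf_le (R : realType) (d : nat) (X : centered_field R d)
    (B : box R d) (lambda K : R) : Prop :=
  log_mgf_le (cf_prob X) (fun w => lambda * fval X B w) K.

(** * Joining two boxes, splitting a box, cutting off a part *)

Section splitting.
Context (R : realType) (n : nat) (X : centered_field R n.+1).
Context (k : 'I_n.+1) (a r b : R) (ar : a < r) (rb : r < b) (B : box R n).
Let ab := lt_trans ar rb.

(** Hoelder with exponents 2 and 2, from additivity alone. The range of lambda is halved, which is
    affordable for a fixed number of doublings. *)
Lemma log_mgf_le_join (lambda K : R) :
  field_log_mgf_le X (insert_box k ar B) (2 * lambda) K ->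
  field_log_mgf_le X (insert_box k rb B) (2 * lambda) K ->
  field_log_mgf_le X (insert_box k ab B) lambda K.
Proof.
move=> h1 h2; set Z1 := fval X (insert_box k ar B); set Z2 := fval X (insert_box k rb B).
apply: (@log_mgf_le_ae _ _ _ _ _ (fun w => lambda * Z1 w + lambda * Z2 w)).
- exact: measurable_scale.
- by apply: measurable_funD; exact: measurable_scale.
- apply: filterS (fval_add X (divides_box_insert k ar rb ab B)) => w <-.
  by rewrite mulrDr.
have -> : K = 2^-1 * K + 2^-1 * K by field.
apply: log_mgf_le_hoelder => //; try exact: measurable_scale.
- by lra.
- by rewrite invrK; under eq_fun do rewrite mulrA.
- by rewrite invrK; under eq_fun do rewrite mulrA.
Qed.

Variable S : field_split X.

(** X is replaced by X^0, whose integral is that of X^- plus that of X^+ minus the leak. Hoelder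
    with exponents 1/s and 1/t separates the leak, and independence makes [K1] and [K2] add. *)
Lemma log_mgf_le_split (s t lambda K1 K2 K : R) : 0 < s -> 0 < t -> s + t = 1 ->
  field_log_mgf_le X (insert_box k ar B) (s^-1 * lambda) K1 ->
  field_log_mgf_le X (insert_box k rb B) (s^-1 * lambda) K2 ->
  field_log_mgf_le (leak S k ar rb) B (- (t^-1 * lambda)) K ->
  field_log_mgf_le X (insert_box k ab B) lambda (s * (K1 + K2) + t * K).
Proof.
move=> s0 t0 st1 h1 h2 h.
apply/(same_law_log_mgf_le _ _ _ (sp0_law S)).
rewrite (_ : (fun w => _) = (fun w =>
   lambda * (fval (spm S) (insert_box k ar B) w + fval (spp S) (insert_box k rb B) w)
   + (- lambda) * leak_val S k ar rb B w)); last first.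
  by apply/funext => w; rewrite leak_valE; ring.
apply: log_mgf_le_hoelder => //.
- by apply: measurable_funM => //; apply: measurable_funD; exact: measurable_funP.
- exact: measurable_scale.
- rewrite (_ : (fun w => _) = (fun w =>
     s^-1 * lambda * fval (spm S) (insert_box k ar B) w
     + s^-1 * lambda * fval (spp S) (insert_box k rb B) w)); last first.
    by apply/funext => w; ring.
  apply: (log_mgf_le_indep_sum (@sp_indep _ _ _ S)).
    exact/(same_law_log_mgf_le _ _ _ (spm_law S)).
  exact/(same_law_log_mgf_le _ _ _ (spp_law S)).
- move: h; rewrite /field_log_mgf_le /=.
  by under eq_fun do rewrite -mulrN -mulrA.
Qed.

(** The same identity read backwards: X^- plus X^+ is X^0 plus the leak, so Hoelder bounds the sum,
    and Jensen removes the independent centered X^+. *)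
Lemma log_mgf_le_cut (lambda K K' : R) :
  field_log_mgf_le X (insert_box k ab B) (2 * lambda) K ->
  field_log_mgf_le (leak S k ar rb) B (2 * lambda) K' ->
  field_log_mgf_le X (insert_box k ar B) lambda (2^-1 * K + 2^-1 * K').
Proof.
move=> h h'.
apply/(same_law_log_mgf_le _ _ _ (spm_law S)).
apply: (log_mgf_le_indep_summand (B' := insert_box k rb B) (@sp_indep _ _ _ S)).
rewrite (_ : (fun w => _) = (fun w => lambda * fval (sp0 S) (insert_box k ab B) w
   + lambda * leak_val S k ar rb B w)); last first.
  by apply/funext => w; rewrite leak_valE; ring.
apply: log_mgf_le_hoelder => //; try exact: measurable_scale.
- by lra.
- rewrite invrK; under eq_fun do rewrite mulrA.
  exact/(same_law_log_mgf_le _ _ _ (sp0_law S)).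
- by rewrite invrK; under eq_fun do rewrite mulrA.
Qed.

End splitting.

(* L stands for any upper bound of log (vol B); decoupling the two keeps the
   admissible lambda fixed while a box is built up from smaller ones. *)
Definition mod_dev_bound (R : realType) (d : nat) (X : centered_field R d) (C : R)
    (A : 'I_d -> set R) : Prop := forall (B : box R d) (lambda L : R),
  sides_in A B -> vol B <= expR L -> 1 <= L -> C * `|lambda| * L ^+ d <= 1 ->
  field_log_mgf_le X B lambda (C * vol B * lambda ^+ 2).

(** * Exponential moments over boxes of bounded size *)

Section bounds.
Context (R : realType) (d : nat) (I : Type) (X : I -> centered_field R d).
Implicit Types (A : 'I_d -> set R).

(** [K] does not involve lambda; the quadratic dependence is recovered afterwards from centering. *)
Definition mgf_bounded A : Prop := exists eps K : R, 0 < eps /\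
  forall i B lambda, sides_in A B -> `|lambda| <= eps ->
    field_log_mgf_le (X i) B lambda K.

(** Sides at least 1 give volume at least 1, so a bound c lambda^2 without the volume is enough; it
    comes from [log_mgf_le_subgaussian]. *)
Lemma mod_dev_bound_of_mgf_bounded A : (forall j x, A j x -> 1 <= x) ->
  mgf_bounded A -> exists2 C, 1 <= C & forall i, mod_dev_bound (X i) C A.
Proof.
move=> A1 [eps [K [eps0 h]]].
set c := 16 * (2 * expR K) / eps ^+ 2.
have c0 : 0 <= c by rewrite /c divr_ge0 ?sqr_ge0// !mulr_ge0 ?expR_ge0.
have e0 : 0 < 2 / eps by rewrite divr_gt0.
(* With [1 <= L], the summand [2 / eps] turns the admissibility condition into |lambda| <= eps /
   2. *)
exists (1 + c + 2 / eps); first by lra.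
move=> i B lambda L AB vB L1 hl.
have V1 : 1 <= vol B by apply: vol_ge1 => j; exact: A1 (AB j).
have le : `|lambda| <= eps / 2.
  rewrite -(@ler_pM2l _ (2 / eps))// (_ : 2 / eps * (eps / 2) = 1); last first.
    by field; rewrite gt_eqF.
  apply: le_trans hl; rewrite -[leLHS]mulr1 ler_pM ?exprn_ege1//.
    by rewrite mulr_ge0// ltW.
  by rewrite ler_wpM2r//; lra.
apply: (@log_mgf_leW _ _ _ _ _ (c * lambda ^+ 2)).
  rewrite ler_wpM2r ?sqr_ge0// -[leLHS]mulr1 ler_pM//; lra.
apply: log_mgf_le_subgaussian => //; try exact: fval_Lfun1; try exact: fval_mean0.
apply: expectation_expR_norm_le; first exact: ltW.
  by apply: h => //; rewrite gtr0_norm.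
by apply: h => //; rewrite normrN gtr0_norm.
Qed.

End bounds.

Section one_coordinate.
Context (R : realType) (n : nat) (I : Type) (X : I -> centered_field R n.+1).
Context (k : 'I_n.+1).
Implicit Types (A : 'I_n.+1 -> set R).

Lemma upd_eq (a : set R) A : upd k a A k = a.
Proof. by rewrite /upd eqxx. Qed.

Lemma upd_upd (a b : set R) A : upd k a (upd k b A) = upd k a A.
Proof. by apply/funext => j; rewrite /upd; case: eqP. Qed.

Lemma upd_id A : upd k (A k) A = A.
Proof. by apply/funext => j; rewrite /upd; case: eqP => // ->. Qed.

Lemma sides_in_upd_insert (a : set R) A u w (uw : u < w) (B : box R n) :
  sides_in (upd k a A) (insert_box k uw B) <->
  a (w - u) /\ sides_in (fun i => A (lift k i)) B.
Proof.
rewrite sides_in_insert_box upd_eq.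
have -> : (fun i => upd k a A (lift k i)) = (fun i => A (lift k i)).
  by apply/funext => i; rewrite /upd eq_sym (negbTE (neq_lift _ _)).
by [].
Qed.

Lemma mgf_bounded_double (x : R) A : A k = [set x] ->
  mgf_bounded X A -> mgf_bounded X (upd k [set 2 * x] A).
Proof.
move=> Ak [eps [K [eps0 h]]]; exists (eps / 2), K; split; first by rewrite divr_gt0.
move=> i B0 lambda; have [u [w [uw [B ->]]]] := insert_boxP k B0.
move=> /sides_in_upd_insert [/= wu AB] hl.
have ur : u < (u + w) / 2 by lra.
have rw : (u + w) / 2 < w by lra.
have hl2 : `|2 * lambda| <= eps by rewrite normrM ger0_norm//; lra.
rewrite (Prop_irrelevance uw (lt_trans ur rw)).
by apply: log_mgf_le_join; apply: h => //; apply/sides_in_insert_box; rewrite Ak;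
  split=> //=; lra.
Qed.

Lemma mgf_bounded_double_iter (x : R) (m : nat) A : A k = [set x] ->
  mgf_bounded X A -> mgf_bounded X (upd k [set 2 ^+ m * x] A).
Proof.
move=> Ak hA; elim: m => [|m IH]; first by rewrite expr0 mul1r -Ak upd_id.
have := mgf_bounded_double (upd_eq _ _) IH.
by rewrite upd_upd mulrA -exprS.
Qed.

Context (S : forall (r : R) (i : I), field_split (X i)) (C : R).
(** Supplied by the induction on the dimension. *)
Hypothesis leak_bound : forall i (a r b : R) (ar : a < r) (rb : r < b),
  mod_dev_bound (leak (S r i) k ar rb) C (fun=> [set x | C <= x]).

(** The interval [u, w] is extended to [u, u + M], where a bound is known, and cut at w. The upper
    bound [N] on all sides keeps the cross-section bounded, so the leak contributes a constant. *)
Lemma mgf_bounded_cut (l M N : R) A : 1 <= C -> C <= l -> 2 * l < M ->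
  A k = [set M] -> (forall j x, A j x -> l <= x <= N) ->
  mgf_bounded X A -> mgf_bounded X (upd k [set x | l <= x <= 2 * l] A).
Proof.
move=> C1 Cl lM Ak Ab [eps [K [eps0 h]]].
have N0 : 0 <= N.
  by have := Ab k M; rewrite Ak => /(_ erefl) /andP[? ?]; lra.
(* Chosen so that the cross-section has volume at most N^n <= exp L, with [1 <= L]. *)
pose L := 1 + N ^+ n.
have L1 : 1 <= L by rewrite lerDl exprn_ge0.
have CL0 : 0 < C * L ^+ n by rewrite mulr_gt0 ?exprn_gt0; lra.
(* Cutting doubles lambda, whence the halves: the first entry serves the extended box, the second
   the admissibility for the leak. *)
pose e' := Num.min (eps / 2) ((C * L ^+ n)^-1 / 2).
exists e', (2^-1 * K + 2^-1 * (C * expR L)); split.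
  by rewrite lt_min !divr_gt0// invr_gt0.
move=> i B0 lambda; have [u [w [uw [B ->]]]] := insert_boxP k B0.
move=> /sides_in_upd_insert [/= /andP[lwu wul] AB]; rewrite le_min => /andP[hl1 hl2].
have wb : w < u + M by lra.
have n2 : `|2 * lambda| = 2 * `|lambda| by rewrite normrM ger0_norm.
apply: (log_mgf_le_cut (S := S w i) (rb := wb)).
  apply: h; last by rewrite n2; lra.
  by apply/sides_in_insert_box; rewrite Ak; split=> //=; lra.
have vB : vol B <= expR L.
  apply: (@le_trans _ _ (N ^+ n)).
    by apply: vol_le_exp => j; have /andP[] := Ab _ _ (AB j).
  by apply: le_trans (expR_ge1Dx L); rewrite /L; lra.
have l2 : C * L ^+ n * `|2 * lambda| <= 1.
  by rewrite n2 -ler_pdivlMl// mulr1; lra.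
have l21 : `|2 * lambda| <= 1.
  apply: le_trans l2; rewrite -[leLHS]mul1r ler_wpM2r//.
  by rewrite -[leLHS]mulr1 ler_pM ?exprn_ege1//; lra.
apply: log_mgf_leW (leak_bound (L := L) i uw wb _ vB L1 _).
- rewrite -mulrA ler_wpM2l//; first by lra.
  rewrite -[leRHS]mulr1 ler_pM ?sqr_ge0//; first exact/ltW/vol_gt0.
  by rewrite -real_normK ?num_real// exprn_ile1.
- by move=> j /=; have /andP[? ?] := Ab _ _ (AB j); lra.
- by rewrite mulrAC.
Qed.

End one_coordinate.

(** * Constants of the doubling recursion *)

Section doubling_constants.
Context (R : realType).

(** Take the least m satisfying the upper bound; minimality gives the lower bound, or [l <= x] does
    if m = 0. *)
Lemma dyadic_scale (l x : R) : 0 < l -> l <= x ->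
  exists m : nat, 2 ^+ m * l <= x <= 2 ^+ m * (2 * l).
Proof.
move=> l0 lx.
have ex : exists m : nat, x <= 2 ^+ m * (2 * l).
  exists (Num.bound (x / l)).
  have xl : x / l <= 2 ^+ (Num.bound (x / l)).
    apply: le_trans (ltW (archi_boundP _)) _; first by rewrite divr_ge0; lra.
    by rewrite -natrX ler_nat ltnW// ltn_expl.
  rewrite ler_pdivrMr// in xl.
  by apply: le_trans xl _; rewrite ler_wpM2l ?exprn_ge0//; lra.
case: (ex_minnP ex) => m hm hmin; exists m; rewrite hm andbT.
case: m hm hmin => [|m] hm hmin; first by rewrite mul1r.
rewrite leNgt; apply/negP => h; have := hmin m.
by rewrite ltnn mulrA -exprSr (ltW h) => /(_ isT).
Qed.

(** Serves to bound the number of doublings: 2^m <= exp L gives m <= 2 L. It suffices that exp (1/2)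
    <= 2, which follows from 1 - 1/2 <= exp (- 1/2). *)
Lemma expR_half_le (m : nat) : expR (m%:R / 2) <= (2 : R) ^+ m.
Proof.
rewrite mulrC expRM_natr; apply: lerXn2r; rewrite ?nnegrE ?expR_ge0//.
have := expR_ge1Dx (- 2^-1 : R); have := expR_gt0 (2^-1 : R).
by rewrite expRN; move: (expR _) => e e0; rewrite -[e^-1]div1r ler_pdivlMr//; lra.
Qed.

Variables (C c L : R).

(** The term 1/L keeps (1 + delta) / delta at most 2 L. The term (3/4)^m, set against a ratio of
    cross-section to volume of at most 2^(-m), leaves leak contributions of order (2/3)^m. *)
Definition step_weight (m : nat) : R := L^-1 + (3 / 4) ^+ m.

(* Closed forms of \sum_(i < m) step_weight i and of \sum_(i < m) (2/3)^i. *)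
Definition weight_sum (m : nat) : R := m%:R / L + 4 * (1 - (3 / 4) ^+ m).
Definition geom_sum (m : nat) : R := 3 * (1 - (2 / 3) ^+ m).

(** An upper solution of the recursion g (m + 1) = (1 + delta_m) (g m + C (2/3)^m), g 0 = c, for the
    coefficient of vol B lambda^2. *)
Definition growth (m : nat) : R := expR (weight_sum m) * (c + C * geom_sum m).

Lemma weight_sumS m : weight_sum m.+1 = weight_sum m + step_weight m.
Proof. by rewrite /weight_sum /step_weight exprS -natr1 mulrDl mul1r; lra. Qed.

Lemma geom_sumS m : geom_sum m.+1 = geom_sum m + (2 / 3) ^+ m.
Proof. by rewrite /geom_sum exprS; lra. Qed.

Lemma geom_sum_ge0 m : 0 <= geom_sum m.
Proof.
have : (2 / 3 : R) ^+ m <= 1 by rewrite exprn_ile1//; lra.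
by rewrite /geom_sum; lra.
Qed.

Lemma geom_sum_le m : geom_sum m <= 3.
Proof.
have : 0 <= (2 / 3 : R) ^+ m by rewrite exprn_ge0//; lra.
by rewrite /geom_sum; lra.
Qed.

Hypotheses (C1 : 1 <= C) (c1 : 1 <= c) (L1 : 1 <= L).

Lemma step_weight_gt0 m : 0 < step_weight m.
Proof.
have L1' : 1 <= L := L1; have L0 : 0 < L by lra.
by rewrite addr_gt0 ?invr_gt0 ?exprn_gt0//; lra.
Qed.

Lemma weight_sum_ge0 m : 0 <= weight_sum m.
Proof.
have L1' : 1 <= L := L1; have L0 : 0 <= L by lra.
have : (3 / 4 : R) ^+ m <= 1 by rewrite exprn_ile1//; lra.
have : 0 <= m%:R / L by rewrite divr_ge0.
by rewrite /weight_sum; lra.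
Qed.

(** The 6 is 2 from m / L plus 4 from the geometric series. *)
Lemma weight_sum_le m : m%:R <= 2 * L -> weight_sum m <= 6.
Proof.
have L1' : 1 <= L := L1; have L0 : 0 < L by lra.
rewrite -ler_pdivrMr// => mL.
have : 0 <= (3 / 4 : R) ^+ m by rewrite exprn_ge0//; lra.
by rewrite /weight_sum; lra.
Qed.

Lemma expR_weight_sum_step m :
  (1 + step_weight m) * expR (weight_sum m) <= expR (weight_sum m.+1).
Proof.
by rewrite weight_sumS expRD mulrC ler_wpM2l ?expR_ge0// expR_ge1Dx.
Qed.

(** The accumulated coefficient uses (1 + delta) exp W_m <= exp W_(m+1), with W the weight sum; the
    new leak term needs only 1 + delta <= exp W_(m+1). *)
Lemma growth_step m :
  (1 + step_weight m) * (growth m + C * (2 / 3) ^+ m) <= growth m.+1.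
Proof.
have C1' : 1 <= C := C1; have c1' : 1 <= c := c1.
have g0 := geom_sum_ge0 m.
have q0 : 0 <= (2 / 3 : R) ^+ m by rewrite exprn_ge0//; lra.
have e1 := expR_weight_sum_step m.
have e2 : 1 + step_weight m <= expR (weight_sum m.+1).
  apply: le_trans e1; rewrite -[leLHS]mulr1 ler_wpM2l//.
    by rewrite addr_ge0// ltW// step_weight_gt0.
  by rewrite -expR0 ler_expR weight_sum_ge0.
have a0 : 0 <= c + C * geom_sum m by rewrite addr_ge0 ?(mulr_ge0 _ g0)//; lra.
have b0 : 0 <= C * (2 / 3) ^+ m by rewrite mulr_ge0//; lra.
have := lerD (ler_wpM2r a0 e1) (ler_wpM2r b0 e2).
by rewrite /growth geom_sumS; lra.
Qed.

Lemma growth_le m : m%:R <= 2 * L -> growth m <= expR 6 * (c + 3 * C).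
Proof.
have C1' : 1 <= C := C1; have c1' : 1 <= c := c1.
move=> mL; have g0 := geom_sum_ge0 m.
rewrite ler_pM ?expR_ge0 ?ler_expR ?weight_sum_le//.
  by rewrite addr_ge0 ?(mulr_ge0 _ g0)//; lra.
by rewrite lerD2l mulrC ler_wpM2r ?geom_sum_le//; lra.
Qed.

End doubling_constants.

(** * Removing the upper bound on one side *)

Section sweep.
Context (R : realType) (n : nat) (I : Type) (X : I -> centered_field R n.+1).
Context (k : 'I_n.+1).
Implicit Types (A : 'I_n.+1 -> set R).
Context (S : forall (r : R) (i : I), field_split (X i)) (C : R).
Hypothesis leak_bound : forall i (a r b : R) (ar : a < r) (rb : r < b),
  mod_dev_bound (leak (S r i) k ar rb) C (fun=> [set x | C <= x]).

(* Halving a long side: Hoelder with exponents 1 + step_weight m for the two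
   independent halves and its conjugate, at most 2 L, for the leak.  The loss
   factors multiply up to a constant, and the leak terms add up geometrically. *)
Lemma mod_dev_bound_scale (l c L : R) A i m : 1 <= C -> 1 <= c -> 1 <= L -> C <= l ->
  (forall j x, A j x -> l <= x) -> A k = [set x | l <= x <= 2 * l] ->
  mod_dev_bound (X i) c A ->
  forall (u w : R) (uw : u < w) (B : box R n) lambda,
  2 ^+ m * l <= w - u <= 2 ^+ m * (2 * l) -> sides_in (fun i => A (lift k i)) B ->
  vol (insert_box k uw B) <= expR L ->
  expR (weight_sum L m) * (c + 2 * C) * `|lambda| * L ^+ n.+1 <= 1 ->
  field_log_mgf_le (X i) (insert_box k uw B) lambda
    (growth C c L m * vol (insert_box k uw B) * lambda ^+ 2).
Proof.
move=> C1 c1 L1 Cl Al Ak h.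
elim: m => [|m IH] u w uw B lambda /andP[lwu wul] AB vB hl.
  rewrite /growth /weight_sum /geom_sum !expr0 !subrr !mulr0 mul0r !addr0 expR0 mul1r.
  apply: (h _ _ L) => //; first by apply/sides_in_insert_box; rewrite Ak;
    split=> //=; move: lwu wul; rewrite !expr0 !mul1r => -> ->.
  apply: le_trans hl; rewrite /weight_sum !expr0 subrr mulr0 mul0r addr0 expR0 mul1r.
  by rewrite -!mulrA ler_wpM2r ?mulr_ge0 ?exprn_ge0//; lra.
set V := vol _ in vB *.
have VE : V = (w - u) * vol B by rewrite /V vol_insert_box.
set dl := step_weight L m; set p := 1 + dl.
have dl0 : 0 < dl := step_weight_gt0 L1 m.
have p0 : 0 < p by rewrite /p; lra.
have ur : u < (u + w) / 2 by lra.
have rw : (u + w) / 2 < w by lra.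
have V0 : 0 < V := vol_gt0 _.
have vB0 : 0 < vol B := vol_gt0 _.
have L0 : 0 < L by lra.
have Ln0 : 0 <= L ^+ n by rewrite exprn_ge0// ltW.
have e0 : 1 <= expR (weight_sum L m.+1) by rewrite -expR0 ler_expR weight_sum_ge0.
have p2m : 1 <= (2 : R) ^+ m by rewrite exprn_ege1//; lra.
(* The admissibility condition carries [expR (weight_sum L m)] so that passing from [lambda] to
   [p * lambda] is absorbed by one more weight. *)
have half (u' w' : R) (uw' : u' < w') : w' - u' = (w - u) / 2 ->
  field_log_mgf_le (X i) (insert_box k uw' B) (p^-1^-1 * lambda)
     (growth C c L m * (V / 2) * (p * lambda) ^+ 2).
  move=> E; rewrite invrK.
  have -> : V / 2 = vol (insert_box k uw' B) by rewrite vol_insert_box E VE mulrAC.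
  apply: IH => //.
  - by rewrite E; move: lwu wul; rewrite exprS; nra.
  - by rewrite vol_insert_box E; apply: le_trans vB; rewrite VE mulrAC; nra.
  - apply: le_trans hl; rewrite normrM gtr0_norm// ler_wpM2r ?exprn_ge0// ?(ltW L0)//.
    rewrite (_ : _ * _ = (p * expR (weight_sum L m)) * ((c + 2 * C) * `|lambda|));
      last by ring.
    rewrite -[leRHS]mulrA ler_wpM2r ?expR_weight_sum_step//.
    by rewrite mulr_ge0//; lra.
have wu1 : 2 ^+ m <= w - u.
  by apply: le_trans lwu; rewrite exprS; nra.
have vBV : vol B <= V * (1 / 2) ^+ m.
  rewrite expr_div_n expr1n mulrA mulr1 ler_pdivlMr ?exprn_gt0// mulrC VE.
  by rewrite ler_wpM2r// ltW.
(* The leak is taken at (p / dl) lambda up to sign, and p / dl <= 2 L spends one of the n + 1 powers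
   of L; this 2 is the one in [c + 2 * C]. *)
have leakm : field_log_mgf_le (leak (S ((u + w) / 2) i) k ur rw) B
    (- ((dl / p)^-1 * lambda)) (C * vol B * (- ((dl / p)^-1 * lambda)) ^+ 2).
  apply: (leak_bound (L := L) i ur rw) => //.
  - by move=> j /=; apply: le_trans Cl (Al _ _ (AB j)).
  - apply: le_trans vB; rewrite VE -[leLHS]mul1r ler_wpM2r ?(ltW vB0)//; lra.
  - rewrite normrN normrM invf_div.
    have q0 : 0 <= p / dl by rewrite divr_ge0 ?ltW.
    have q2 : p / dl <= 2 * L.
      have dL : 1 <= dl * L.
        rewrite /dl /step_weight mulrDl mulVf ?gt_eqF// lerDl mulr_ge0 ?exprn_ge0//; lra.
      by rewrite ler_pdivrMr// /p; nra.
    rewrite ger0_norm//; apply: le_trans hl; rewrite exprS.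
    rewrite (_ : C * _ * _ = (p / dl * C) * (`|lambda| * L ^+ n)); last by ring.
    rewrite [leRHS](_ : _ =
      (expR (weight_sum L m.+1) * (c + 2 * C) * L) * (`|lambda| * L ^+ n));
      last by ring.
    rewrite ler_wpM2r ?mulr_ge0//.
    apply: (@le_trans _ _ (2 * L * C)); first by rewrite ler_wpM2r//; lra.
    rewrite (_ : 2 * L * C = 1 * (2 * C) * L); last by ring.
    by rewrite ler_wpM2r ?ler_pM//; lra.
rewrite (Prop_irrelevance uw (lt_trans ur rw)).
have sp : p^-1 + dl / p = 1 by rewrite /p; field; rewrite gt_eqF.
have h1 := half _ _ ur _; have h2 := half _ _ rw _.
apply: log_mgf_leW (log_mgf_le_split _ _ sp (h1 _) (h2 _) leakm); try lra; last 2 first.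
- by rewrite invr_gt0.
- by rewrite divr_gt0.
rewrite [leLHS](_ : _ =
  (p * growth C c L m * V + p * C * (dl^-1 * vol B)) * lambda ^+ 2); last first.
  by field; rewrite !gt_eqF.
rewrite ler_wpM2r ?sqr_ge0//.
(* The second term of [step_weight] gives 1 / dl <= (4/3)^m, and [vBV] contributes (1/2)^m. *)
have dV : dl^-1 * vol B <= (2 / 3) ^+ m * V.
  apply: (@le_trans _ _ ((4 / 3) ^+ m * (V * (1 / 2) ^+ m))).
    rewrite ler_pM ?invr_ge0// ?(ltW vB0) ?(ltW dl0)//.
    have q1 : (4 / 3 : R) ^+ m * (3 / 4) ^+ m = 1.
      by rewrite -exprMn (_ : 4 / 3 * (3 / 4) = 1 :> R) ?expr1n//; field.
    rewrite -[dl^-1]div1r ler_pdivrMr// /dl /step_weight mulrDr q1 lerDr.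
    by rewrite mulr_ge0 ?exprn_ge0 ?invr_ge0//; lra.
  by rewrite mulrCA -exprMn mulrC (_ : 4 / 3 * (1 / 2) = 2 / 3 :> R)//; field.
apply: (@le_trans _ _ ((1 + step_weight L m) * (growth C c L m + C * (2 / 3) ^+ m) * V)).
  rewrite -/dl -/p [leRHS](_ : _ =
    p * growth C c L m * V + p * C * ((2 / 3) ^+ m * V)); last by ring.
  by rewrite lerD2l ler_wpM2l// mulr_ge0//; lra.
by rewrite ler_wpM2r ?growth_step// ltW.
Qed.

(** [dyadic_scale] places the side between 2^m l and 2^(m+1) l; m <= 2 L then makes the bound of
    [mod_dev_bound_scale] uniform in m. *)
Lemma mod_dev_bound_sweep (l c : R) A : 1 <= C -> 1 <= c -> C <= l ->
  (forall j x, A j x -> l <= x) -> A k = [set x | l <= x <= 2 * l] ->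
  (forall i, mod_dev_bound (X i) c A) ->
  exists2 c' : R, 1 <= c' &
    forall i, mod_dev_bound (X i) c' (upd k [set x | l <= x] A).
Proof.
move=> C1 c1 Cl Al Ak h.
have e6 : 1 <= expR (6 : R) by rewrite -expR0 ler_expR.
exists (expR 6 * (c + 3 * C)).
  by rewrite -[leLHS]mulr1 ler_pM//; lra.
move=> i B0 lambda L; have [u [w [uw [B ->]]]] := insert_boxP k B0.
move=> /sides_in_upd_insert [/= lwu AB] vB L1 hl.
have l0 : 0 < l by lra.
have [m mwu] := dyadic_scale l0 lwu.
have V0 := vol_gt0 (insert_box k uw B).
(* Since l and the other sides are at least 1, 2^m is at most the volume, hence at most exp L. *)
have mL : m%:R <= 2 * L.
  rewrite -ler_pdivrMl// mulrC -ler_expR; apply: le_trans (expR_half_le R m) _.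
  apply: le_trans vB; rewrite vol_insert_box -[leLHS]mulr1; case/andP: mwu => mwu _.
  apply: ler_pM => //.
    apply: le_trans mwu; rewrite -[leLHS]mulr1 ler_wpM2l ?exprn_ge0//; lra.
  by apply: vol_ge1 => j; have := Al _ _ (AB j); lra.
apply: (log_mgf_leW _ (mod_dev_bound_scale C1 c1 L1 Cl Al Ak (h i) mwu AB vB _)).
  by rewrite ler_wpM2r ?sqr_ge0// ler_wpM2r ?growth_le// ltW.
apply: le_trans hl; rewrite ler_wpM2r ?exprn_ge0//; first lra.
rewrite ler_wpM2r// ler_pM ?expR_ge0 ?ler_expR ?weight_sum_le//; lra.
Qed.

End sweep.

(** * Induction on the dimension and conclusion *)

Lemma mod_dev_boundW (R : realType) (d : nat) (X : centered_field R d) (C C' : R)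
    (A A' : 'I_d -> set R) : C <= C' -> (forall j, A' j `<=` A j) ->
  mod_dev_bound X C A -> mod_dev_bound X C' A'.
Proof.
move=> CC' AA' h B lambda L AB vB L1 hl.
apply: (@log_mgf_leW _ _ _ _ _ (C * vol B * lambda ^+ 2)).
  by rewrite ler_wpM2r ?sqr_ge0// ler_wpM2r// ltW// vol_gt0.
apply: (h _ _ L) => //; first by move=> j; apply: AA'; exact: AB.
by apply: le_trans hl; rewrite ler_wpM2r ?exprn_ge0 ?ler_wpM2r//; lra.
Qed.

Lemma exp_moment_log_mgf_le (R : realType) (d : nat) (X : centered_field R d)
    (B : box R d) (eps lambda : R) :
  exp_moment_le2 X B eps -> `|lambda| <= eps -> field_log_mgf_le X B lambda 1.
Proof.
move=> h le; apply: (@le_trans _ _ 2%:E); last first.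
  by rewrite lee_fin; apply: le_trans (expR_ge1Dx _); lra.
apply: le_trans h; apply: expectation_le.
- exact/measurable_expR_comp/measurable_scale.
- apply: measurable_expR_comp; apply: measurable_funM => //.
  by apply: measurableT_comp => //; exact: measurable_funP.
- by move=> w; apply: expR_ge0.
- by move=> w; apply: expR_ge0.
- apply: aeW => w; rewrite ler_expR; apply: le_trans (ler_norm _) _.
  by rewrite normrM ler_wpM2r.
Qed.

(** Boxes with the same sides as [B] are its translates, which hypothesis (a) controls. *)
Lemma mgf_bounded_shift (R : realType) (d : nat) (I : Type)
    (X : I -> centered_field R d) (B : box R d) (eps : R) : 0 < eps ->
  (forall i s, exp_moment_le2 (X i) (shift_box B s) eps) ->
  mgf_bounded X (fun j => [set side B j]).
Proof.
move=> eps0 h; exists eps, 1; split=> // i B' lambda AB le.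
apply: exp_moment_log_mgf_le le.
rewrite (_ : B' = shift_box B (lo B' - lo B)); first exact: h.
apply: box_eq; apply/rowP => j; rewrite /= !mxE; first by rewrite addrC subrK.
by have := AB j; rewrite /side /=; lra.
Qed.

(** The box of hypothesis (a) may be tiny; a common number of doublings for all directions is the
    maximum of the individual ones. *)
Lemma dyadic_sides (R : realType) (d : nat) (B : box R d) (M : R) : 0 <= M ->
  exists m : nat, forall j, M < 2 ^+ m * side B j.
Proof.
move=> M0; exists (\max_(j < d) Num.bound (M / side B j)) => j.
rewrite -ltr_pdivrMr ?side_gt0//.
apply: lt_le_trans (archi_boundP _) _; first by rewrite divr_ge0// ltW// side_gt0.
rewrite -natrX ler_nat.
apply: (leq_trans (leq_bigmax (F := fun j => Num.bound (M / side B j)) j)).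
exact/ltnW/ltn_expl.
Qed.

Lemma uniformly_splittable_mod_dev (R : realType) (d : nat) (I : Type)
    (X : I -> centered_field R d) : uniformly_splittable X ->
  exists2 C : R, 1 <= C &
    forall i, mod_dev_bound (X i) C (fun=> [set x | C <= x]).
Proof.
elim: d I X => [|n IH] I X /=.
  move=> [eps eps0 h].
  (* In dimension 0 conditions on sides are vacuous and the volume is an empty product, so the
     moment hypothesis and centering suffice. *)
  have [||C C1 hC] := @mod_dev_bound_of_mgf_bounded _ _ _ X (fun=> setT).
  - by case.
  - by exists eps, 1; split=> // i B lambda _; exact: exp_moment_log_mgf_le.
  by exists C => // i; apply: mod_dev_boundW (hC i).
move=> [[B0 [eps [eps0 hB0]]] [S /IH [C C1 hC]]].
have leak_bound k i (a r b : R) (ar : a < r) (rb : r < b) :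
    mod_dev_bound (leak (S k r i) k ar rb) C (fun=> [set x | C <= x]).
  exact: hC (k, Strip ar rb, i).
(* Cutting down to sides in [C, 2 C] needs starting sides beyond 2 C. *)
have [|m hm] := @dyadic_sides _ _ B0 (2 * C); first by lra.
(* Bounds the sides in every mixed family: those already cut are at most 2 C, which is below [N]
   too. *)
pose N := \sum_j 2 ^+ m * side B0 j.
have hN j : 2 ^+ m * side B0 j <= N.
  rewrite /N (bigD1 j)//= lerDl sumr_ge0// => i _.
  by rewrite mulr_ge0 ?exprn_ge0// ltW// side_gt0.
have h1 : mgf_bounded X (fun j => [set 2 ^+ m * side B0 j]).
  apply: coordinatewise_ind (mgf_bounded_shift eps0 hB0) => k T _ Tk.
  exact: mgf_bounded_double_iter.
have h2 : mgf_bounded X (fun=> [set x | C <= x <= 2 * C]).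
  apply: coordinatewise_ind h1 => k T TA Tk.
  apply: (mgf_bounded_cut (leak_bound k) (N := N) C1 _ (hm k) Tk) => // j x.
  have := hN j; have := hm j.
  by case: (TA j) => -> /= h h'; [move=> ->|move=> /andP[? ?]]; apply/andP; split; lra.
have [|c c1 hc] := mod_dev_bound_of_mgf_bounded _ h2.
  by move=> j x /= /andP[? ?]; lra.
(* Each sweep turns one window [C, 2 C] into a ray, at the price of a larger constant. *)
have [c' c'1 hc'] : exists2 c : R, 1 <= c &
    forall i, mod_dev_bound (X i) c (fun=> [set x | C <= x]).
  pose Q (T : 'I_n.+1 -> set R) := exists2 c : R, 1 <= c &
    forall i, mod_dev_bound (X i) c T.
  apply: (coordinatewise_ind (Q := Q) _ (ex_intro2 _ _ c c1 hc)) => k T TA Tk [b b1 hb].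
  apply: (mod_dev_bound_sweep (leak_bound k) C1 b1) => // j x.
  by case: (TA j) => -> // /andP[].
exists (c' + C); first by lra.
move=> i; apply: mod_dev_boundW (hc' i); first by lra.
by move=> j x /=; lra.
Qed.

Lemma side_ge_width (R : realType) (d : nat) (B : box R d) (C : R) j :
  (C%:E <= width B)%E -> C <= side B j.
Proof.
by move=> h; rewrite -lee_fin; apply: le_trans h _; exact: bigmin_le_cond.
Qed.

(** [lne] is -oo at nonpositive arguments; elsewhere monotonicity of [ln] applies. *)
Lemma lne_le_EFin (R : realType) (x : \bar R) (K : R) :
  (x <= (expR K)%:E)%E -> (lne x <= K%:E)%E.
Proof.
case: x => [r| |] //=; last by rewrite !leNye.
case: ifPn => [_|]; first by rewrite leNye.
by rewrite -ltNge !lee_fin => r0 rK; rewrite -[leRHS]expRK ler_ln ?posrE ?expR_gt0.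
Qed.

Theorem theorem1p5 (R : realType) (d : nat) (d_ge1 : (1 <= d)%N)
    (I : Type) (X : I -> centered_field R d) (usX : uniformly_splittable X) :
  exists2 C : R, 1 < C &
    forall (i : I) (B : box R d) (lambda : R),
      C * `|lambda| <= (ln (vol B) ^+ d)^-1 ->
      (C%:E <= width B)%E ->
      (lne ('E_(cf_prob (X i))[fun w => expR (lambda * fval (X i) B w)])
        <= (C * vol B * lambda ^+ 2)%:E)%E.
Proof.
have [C C1 hC] := uniformly_splittable_mod_dev usX.
(* The 4 makes the volume at least 4 >= e, hence ln (vol B) >= 1, as [mod_dev_bound] demands of
   L. *)
exists (C + 4); first by lra.
move=> i B lambda hl hw; apply: lne_le_EFin.
have sB j : C + 4 <= side B j by apply: side_ge_width.
(* [d_ge1] provides one side of length at least 4; the others are at least 1. *)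
have vB : 4 <= vol B.
  case: d d_ge1 X usX hC B sB {hl hw} => // n _ X usX hC B sB.
  have [u [w [uw [B' E]]]] := insert_boxP ord0 B.
  rewrite E in sB *; rewrite vol_insert_box -[leLHS]mulr1.
  apply: ler_pM => //.
    by have := sB ord0; rewrite side_insert_box; lra.
  apply: vol_ge1 => j; have := sB (lift ord0 j).
  by rewrite side_insert_box_lift; lra.
have v0 := vol_gt0 B.
have L1 : 1 <= ln (vol B).
  rewrite -[leLHS]expRK ler_ln ?posrE ?expR_gt0//; apply: le_trans vB.
  by have := expR_half_le R 2; rewrite divff// -natrX.
have Ld0 : 0 < ln (vol B) ^+ d by rewrite exprn_gt0//; lra.
have hB : mod_dev_bound (X i) (C + 4) (fun=> [set x | C + 4 <= x]).
  by apply: mod_dev_boundW (hC i); [lra|move=> j x /=; lra].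
apply: (hB B lambda (ln (vol B))) => //; first by rewrite lnK.
by rewrite -ler_pdivlMr// div1r.
Qed.
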